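(* Let $P$ be the permutation matrix of a $c$-blockable $k$-permutation $\sigma[P_1,\dots,P_c]$, and let $a>0$ be such that each block satisfies $\mathrm{ex}_{P_i}(n)\le k^a n$ for all $n$. Then for all $n$, $$\mathrm{ex}_P(n)\le k^{\alpha}n,\qquad\text{where } \alpha=2a+8c^2+32ac^2\ln c.$$
   Context: For a permutation $\sigma$ of length $c$ and nonempty permutations $P_1,\dots,P_c$, the inflation $\sigma[P_1,\dots,P_c]$ replaces each entry $\sigma(i)$ by an interval of consecutive values order-isomorphic to $P_i$, the intervals arranged order-isomorphically to $\sigma$; such a permutation is $c$-blockable with blocks $P_i$. Permutations are identified with their permutation matrices. A binary matrix $A$ contains a binary matrix $P$ if some submatrix of $A$ (chosen rows and columns in order) of the same dimensions as $P$ has a 1 wherever $P$ has a 1; otherwise $A$ avoids $P$. $\mathrm{ex}_P(n)$ is the maximum number of ones in an $n\times n$ binary matrix avoiding $P$. *)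

(* Defs.v *)
From mathcomp Require Import all_boot all_order all_algebra perm.

Set Implicit Arguments.
Unset Strict Implicit.
Unset Printing Implicit Defensive.

Import Order.TTheory GRing.Theory.

(* Binary matrices are matrices over bool. *)

Definition increasing p m (f : {ffun 'I_p -> 'I_m}) : bool :=
  [forall i : 'I_p, forall j : 'I_p, (i < j)%N ==> (f i < f j)%N].

Definition contains m n p q (A : 'M[bool]_(m, n)) (P : 'M[bool]_(p, q)) : bool :=
  [exists f : {ffun 'I_p -> 'I_m}, exists g : {ffun 'I_q -> 'I_n},
    [&& increasing f, increasing g &
        [forall i, forall j, P i j ==> mxsub f g A i j]]].

Definition ones m n (A : 'M[bool]_(m, n)) : nat :=
  #|[set ij : 'I_m * 'I_n | A ij.1 ij.2]|.

Definition extremal p q (P : 'M[bool]_(p, q)) (n : nat) : nat :=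
  \max_(A : 'M[bool]_n | ~~ contains A P) ones A.

(* Permutation matrices are the library's perm_mx, with coefficients in the   *)
(* ring bool, where 1 is true and 0 is false.                                 *)
Lemma perm_mx_boolE n (s : 'S_n) i j :
  (perm_mx s : 'M[bool]_n) i j = (s i == j).
Proof. by rewrite !mxE; case: eqP. Qed.

Section Inflation.
Variables (c : nat) (sigma : 'S_c) (m : 'I_c -> nat).
Variable P : forall i : 'I_c, 'S_(m i).

(* An entry of the inflation is given by a pair (i, t): the t-th entry of the *)
(* i-th block. The values of that block form an interval that starts above    *)
(* the values of all the blocks j with sigma j < sigma i; inside the interval *)
(* they are ordered by P i.                                                   *)
Definition inflation_val (x : {i : 'I_c & 'I_(m i)}) : nat :=
  \sum_(j < c | sigma j < sigma (tag x)) m j + P (tag x) (tagged x).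

Lemma inflation_base_le (i : 'I_c) (B : pred 'I_c) :
    (forall j, sigma j <= sigma i -> B j) ->
  \sum_(j < c | sigma j < sigma i) m j + m i <= \sum_(j | B j) m j.
Proof.
move=> sub; have Bi : B i by apply: sub.
rewrite [leqRHS](bigD1 i Bi) /= addnC leq_add2l.
rewrite big_mkcond [leqRHS]big_mkcond /=; apply: leq_sum => j _.
case: ifP => // lt_ji; have -> // : B j && (j != i).
by rewrite sub 1?ltnW //=; apply: contraTneq lt_ji => ->; rewrite ltnn.
Qed.

Lemma inflation_val_lt x : inflation_val x < \sum_i m i.
Proof.
apply: leq_trans (@inflation_base_le (tag x) xpredT _) => //.
by rewrite ltn_add2l.
Qed.

(* The positions 0, ..., \sum_i m i - 1 are split into consecutive intervals  *)
(* of lengths m 0, ..., m (c - 1); tagnat.sig sends a position to the pair    *)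
(* (i, t) of the index of its interval and its offset in that interval.       *)
Definition inflation_fun (s : 'I_(\sum_i m i)) : 'I_(\sum_i m i) :=
  Ordinal (inflation_val_lt (tagnat.sig s)).

Lemma inflation_val_mono x y :
  sigma (tag x) < sigma (tag y) -> inflation_val x < inflation_val y.
Proof.
move=> lt_xy; apply: leq_trans (leq_addr _ _).
apply: leq_trans (@inflation_base_le (tag x) _ _); first by rewrite ltn_add2l.
by move=> j le_jx; apply: leq_ltn_trans lt_xy.
Qed.

Lemma inflation_val_inj : injective inflation_val.
Proof.
move=> x y eq_xy.
have [lt|lt|/val_inj/perm_inj eq_i] := ltngtP (sigma (tag x)) (sigma (tag y)).
- by move: (inflation_val_mono lt); rewrite eq_xy ltnn.
- by move: (inflation_val_mono lt); rewrite eq_xy ltnn.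
case: x y eq_i eq_xy => [i t] [j u] /= eq_ij; case: j / eq_ij u => u.
by rewrite /inflation_val /= => /addnI/val_inj/perm_inj->.
Qed.

Lemma inflation_inj : injective inflation_fun.
Proof. by move=> s t [/inflation_val_inj/tagnat.sig_inj]. Qed.

Definition inflation : 'S_(\sum_i m i) := perm inflation_inj.

Lemma inflationE (i : 'I_c) (t : 'I_(m i)) (s : 'I_(\sum_i m i)) :
    s = \sum_(j < c | j < i) m j + t :> nat ->
  inflation s = \sum_(j < c | sigma j < sigma i) m j + P i t :> nat.
Proof.
move=> s_it; have -> : s = tagnat.rank (Tagged (fun i => 'I_(m i)) t).
  by apply: val_inj; rewrite [RHS]tagnat.rankEsum.
by rewrite permE /= tagnat.rankK.
Qed.

End Inflation.

(* Main.v *)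
(* A contraction argument in the style of Marcus and Tardos, with c-splittings *)
(* in the place of k-subsets. Put V = floor(k^a) + 1, q = c V and t = 4 q^2,  *)
(* and cut a matrix avoiding the inflation into t * t blocks. The matrix of   *)
(* nonempty blocks still avoids the inflation. A block with fewer than q      *)
(* nonempty rows and fewer than q nonempty columns has at most q^2 = t / 4    *)
(* ones. If a strip had more than c t^(c+1) blocks with q nonempty columns,   *)
(* then c t of them would share a splitting of the t columns into c intervals *)
(* with V nonempty columns each; in c groups of t such blocks every interval  *)
(* carries at least V t > ex_{P_i}(t) ones, hence contains P_i, and these     *)
(* copies assemble into the inflation. The resulting recursion                *)
(* T(n) <= q^2 T(n/t + 1) + 2 c t^(c+3) (n/t + 1) has the solution            *)
(* T(n) <= 8 c t^(c+2) n.                                                     *)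
Require Import Defs.
From mathcomp Require Import all_boot all_order all_algebra perm zify lra.
From mathcomp Require Import reals exp.

Import Order.TTheory GRing.Theory Num.Theory.

Set Implicit Arguments.
Unset Strict Implicit.

(** A permutation occurs in a 0-1 matrix when some ones have their rows ordered like its positions
    and their columns like its values. For an inflation both orders are lexicographic, first by
    block and then inside a block ([inflation_occurs]). So it suffices to find c groups of rows and
    c intervals of columns such that the cell assigned to each block contains that block.
    [strip_bound] finds such a grid in any strip with too many wide blocks, and [weight_avoiding]
    turns this into the bound 8 c t^(c+2) n with t = 4 (c V)^2, where V just exceeds k^a.

    As c <= k, this is at most k^(4 + (2a+6)(c+2)) n, and the exponent is below alpha for c >= 2.
    For c = 1 the inflation is its only block. *)

(** * Occurrences of patterns in matrices indexed by the naturals *)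

(** The two orders are arbitrary relations on an index type, so that transposition just swaps [r]
    and [s], and blocks assemble without arithmetic on positions. *)
Definition occurs (T : Type) (r s : T -> T -> Prop) (A : nat -> nat -> bool) :=
  exists F G : T -> nat,
    [/\ forall x y, r x y -> F x < F y,
        forall x y, s x y -> G x < G y &
        forall x, A (F x) (G x)].

Definition weight n (A : nat -> nat -> bool) : nat :=
  \sum_(0 <= i < n) \sum_(0 <= j < n) A i j.

Definition forces (T : Type) (r s : T -> T -> Prop) (V : nat) :=
  forall n A, 0 < n -> V * n <= weight n A ->
  occurs r s (fun i j => [&& i < n, j < n & A i j]).

Definition lex (I : Type) (T : I -> Type) (rho : I -> nat)
    (r : forall i, T i -> T i -> Prop) (x y : {i : I & T i}) : Prop :=
  rho (tag x) < rho (tag y) \/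
  exists i u v, [/\ x = Tagged T u, y = Tagged T v & @r i u v].

Lemma weight_transpose n A : weight n (fun i j => A j i) = weight n A.
Proof. exact: exchange_big. Qed.

Lemma occurs_transpose T (r s : T -> T -> Prop) A :
  occurs r s A -> occurs s r (fun i j => A j i).
Proof. by case=> F [G [HF HG HA]]; exists G, F. Qed.

Lemma forces_transpose T (r s : T -> T -> Prop) V : forces r s V -> forces s r V.
Proof.
move=> frs n A n0 hV; have [|F [G [HF HG HA]]] := frs n (fun i j => A j i) n0.
  by rewrite weight_transpose.
by exists G, F; split=> // x; case/and3P: (HA x) => -> -> ->.
Qed.

(** Under a monotone map, a strict inequality between images holds already between preimages. Taking
    for [h] and [h'] division by t or a shift, patterns lift from the contracted matrix or from a
    strip. *)
Lemma occurs_lift (T : finType) (r s : T -> T -> Prop) (A B : nat -> nat -> bool)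
    (h h' : nat -> nat) :
    {homo h : i j / i <= j} -> {homo h' : i j / i <= j} ->
    (forall I J, B I J -> exists i j, [/\ h i = I, h' j = J & A i j]) ->
  occurs r s B -> occurs r s A.
Proof.
move=> hh hh' BA [F [G [HF HG HB]]].
have lt_h (k : nat -> nat) i j : {homo k : i j / i <= j} -> k i < k j -> i < j.
  by move=> hk; apply: contraLR; rewrite -!leqNgt; apply: hk.
have /fin_all_exists[p Hp] x : exists p : nat * nat,
    [/\ h p.1 = F x, h' p.2 = G x & A p.1 p.2].
  by have [i [j ?]] := BA _ _ (HB x); exists (i, j).
exists (fun x => (p x).1), (fun x => (p x).2); split=> [x y|x y|x].
- by have [Fx _ _] := Hp x; have [Fy _ _] := Hp y => /HF; rewrite -Fx -Fy; apply: lt_h.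
- by have [_ Gx _] := Hp x; have [_ Gy _] := Hp y => /HG; rewrite -Gx -Gy; apply: lt_h.
- by have [] := Hp x.
Qed.

Lemma occurs_lex (I : Type) (T : I -> Type) (rho tau : I -> nat)
    (r s : forall i, T i -> T i -> Prop) (A : nat -> nat -> bool)
    (F G : forall i, T i -> nat) :
    (forall i j u v, rho i < rho j -> F i u < F j v) ->
    (forall i j u v, tau i < tau j -> G i u < G j v) ->
    (forall i u v, r i u v -> F i u < F i v) ->
    (forall i u v, s i u v -> G i u < G i v) ->
    (forall i u, A (F i u) (G i u)) ->
  occurs (lex rho r) (lex tau s) A.
Proof.
move=> Frho Gtau Fr Gs HA.
exists (fun x => F _ (tagged x)), (fun x => G _ (tagged x)).
split=> [x y [/Frho->|[i [u [v [-> -> /Fr]]]]]|x y [/Gtau->|[i [u [v [-> -> /Gs]]]]]|x] //.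
Qed.

(** * Splitting a row into c intervals with many ones each *)

Lemma sum_shift_window (f : nat -> nat) a b t : a <= b -> b <= t ->
  \sum_(0 <= x < t) (if a + x < b then f (a + x) else 0) =
  \sum_(a <= x < b) f x.
Proof.
move=> ab bt; have -> : \sum_(a <= x < b) f x = \sum_(0 <= x < b - a) f (x + a).
  by rewrite -{1}[a]add0n big_addn.
rewrite (big_cat_nat (n := b - a)) //=; last lia.
rewrite [X in _ + X]big_nat_cond [X in _ + X]big1 ?addn0; last first.
  by move=> x /andP[/andP[? ?] _]; rewrite ifF //; lia.
by apply: eq_big_nat => x hx; rewrite addnC ifT //; lia.
Qed.

(** Discrete intermediate values: prefix sums of a 0-1 sequence grow by at most one. *)
Lemma prefix_sum_value (f : nat -> bool) t v : v <= \sum_(0 <= x < t) f x ->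
  exists2 a, a <= t & \sum_(0 <= x < a) f x = v.
Proof.
elim: t => [|t IH] hv; first by exists 0 => //; move: hv; rewrite big_geq //; lia.
have [/IH[a ? <-]|lt] := leqP v (\sum_(0 <= x < t) f x); first by exists a => //; lia.
exists t.+1 => //; apply/eqP; rewrite eqn_leq hv andbT.
by apply: leq_trans lt; rewrite big_nat_recr //=; case: (f t); lia.
Qed.

(* [b i] is the left end of the [i]-th interval; the last one ends at [t], the *)
(* value of [breakpoint b i] for [i >= c].                                    *)
Definition breakpoint c t (b : {ffun 'I_c -> 'I_t}) (i : nat) : nat :=
  oapp (fun j => val (b j)) t (insub i).

Definition splits c t (b : {ffun 'I_c -> 'I_t}) V (f : nat -> bool) : bool :=
  [forall i : 'I_c, (breakpoint b i <= breakpoint b i.+1) &&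
     (V <= \sum_(breakpoint b i <= x < breakpoint b i.+1) f x)].

(** Cut where the prefix sum reaches i V. For i < c this happens strictly before t, and the last
    interval takes the surplus. *)
Lemma splits_exists (f : nat -> bool) c V t :
    0 < V -> c * V <= \sum_(0 <= x < t) f x ->
  exists b : {ffun 'I_c -> 'I_t}, splits b V f.
Proof.
move=> V0 hcV; set S := fun a => \sum_(0 <= x < a) f x.
have /fin_all_exists[e He] (i : 'I_c) : exists a : 'I_t, S a = i * V.
  have [|a at_ Sa] := @prefix_sum_value f t (i * V).
    by apply: leq_trans hcV; rewrite leq_mul2r ltnW ?orbT.
  suff lt_at : a < t by exists (Ordinal lt_at).
  rewrite ltn_neqAle at_ andbT.
  apply: contraTneq hcV => <-; rewrite Sa -ltnNge ltn_mul2r V0 /=; exact: ltn_ord.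
exists (finfun e); apply/forallP => i.
set p := breakpoint _ _; set q := breakpoint _ _.
have Sp : S p = i * V by rewrite /p /breakpoint valK /= ffunE.
have Sq : i.+1 * V <= S q.
  rewrite /q /breakpoint; case: insubP => [j _ <- /=|]; first by rewrite ffunE He.
  by rewrite -leqNgt /= => ci; apply: leq_trans hcV; rewrite leq_mul2r ltn_ord orbT.
have pq : p <= q.
  rewrite leqNgt; apply/negP => qp; have : S q <= S p.
    by rewrite /S [leqRHS](big_cat_nat (n := q)) //= ?leq_addr // ltnW.
  by rewrite Sp leqNgt (leq_trans _ Sq) // ltn_mul2r V0 /=.
rewrite pq /=; move: Sq; rewrite /S (big_cat_nat (n := p)) //= -/(S p) Sp mulSn; lia.
Qed.

Lemma splits_mono c t (b : {ffun 'I_c -> 'I_t}) V f i j :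
  splits b V f -> i <= j -> breakpoint b i <= breakpoint b j.
Proof.
move=> /forallP bV; apply: (@homo_leq _ _ leq) => [//|y x z|k]; first exact: leq_trans.
have [kc|ck] := ltnP k c; first by have /andP[] := bV (Ordinal kc).
by rewrite /breakpoint insubF ?insubF //; apply/negbTE; rewrite -leqNgt // leqW.
Qed.

Lemma breakpoint_le c t (b : {ffun 'I_c -> 'I_t}) i : breakpoint b i <= t.
Proof. by rewrite /breakpoint; case: insubP => //= j _ _; apply: ltnW. Qed.

(** * Wide blocks in one strip *)

Lemma pigeonhole (U : finType) (R : nat -> U -> bool) (P : pred nat) s K :
    (forall y, P y -> exists b, R y b) -> #|U| * K < count P s ->
  exists b, K < count (R ^~ b) s.
Proof.
move=> PR hlt; have [b hb|le] := pickP (fun b => K < count (R ^~ b) s).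
  by exists b.
suff: #|U| * K < #|U| * K by rewrite ltnn.
apply: leq_trans hlt _; rewrite -sum_nat_const.
apply: (@leq_trans (\sum_(b : U) count (R ^~ b) s)); last first.
  by apply: leq_sum => b _; rewrite leqNgt le.
elim: s {le} => [|y s IH] //=; rewrite big_split /= leq_add //.
case Py: (P y) => //; have [b Rb] := PR _ Py.
by rewrite (bigD1 b) //= Rb.
Qed.

(* Among the rows with at least [c * V] ones, at most [c * t] share a given   *)
(* splitting of the columns into [c] intervals carrying [V] ones each:        *)
(* otherwise [c] groups of [t] such rows would give a [c * c] grid of         *)
(* rectangles each of which contains every block.                             *)
Lemma strip_bound c (T : 'I_c -> finType) (r s : forall i, T i -> T i -> Prop)
    (rho tau : 'I_c -> 'I_c) V t n (B : nat -> nat -> bool) :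
    0 < V -> (forall i, forces (r i) (s i) V) ->
    ~ occurs (lex rho r) (lex tau s) (fun y x => (x < t) && B y x) ->
  \sum_(0 <= y < n) (c * V <= \sum_(0 <= x < t) B y x) <= t ^ c * (c * t).
Proof.
move=> V0 hforce avoid; pose wide y := c * V <= \sum_(0 <= x < t) B y x.
rewrite leqNgt; apply/negP => many; apply: avoid.
have [y /(splits_exists V0)//||b hb] := @pigeonhole {ffun 'I_c -> 'I_t}
    (fun y b => splits b V (B y)) wide (index_iota 0 n) (c * t).
  rewrite card_ffun !card_ord -sum1_count big_mkcond /=.
  by rewrite (eq_bigr (fun y => wide y : nat)) // => y _; case: (wide y).
set R := [seq y <- index_iota 0 n | splits b V (B y)].
have szR : c * t < size R by rewrite size_filter.
have ltR i j : i < j -> j < size R -> nth 0 R i < nth 0 R j.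
  move=> ij jR; apply: (sorted_ltn_nth ltn_trans) => //; rewrite ?inE //.
    by apply: sorted_filter; [exact: ltn_trans | exact: iota_ltn_sorted].
  exact: ltn_trans jR.
have splR i : i < size R -> splits b V (B (nth 0 R i)).
  by move=> iR; have := mem_nth 0 iR; rewrite mem_filter => /andP[].
have bmono i j : i <= j -> breakpoint b i <= breakpoint b j.
  by apply: splits_mono (splR 0 _); apply: leq_ltn_trans szR.
have idx (i : 'I_c) y : y < t -> i * t + y < size R.
  move=> yt; apply: ltn_trans szR; apply: (@leq_trans (i.+1 * t)); first lia.
  by rewrite leq_mul2r ltn_ord orbT.
(* The cell of block i: t selected rows from group [rho i], and the columns of interval [tau i]
   shifted to the origin and padded with zeros to width t. Each of its rows has at least V ones, so
   [forces] applies to this t by t square. *)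
pose cell (i : 'I_c) y x :=
  (breakpoint b (tau i) + x < breakpoint b (tau i).+1) &&
  B (nth 0 R (rho i * t + y)) (breakpoint b (tau i) + x).
have /fin_all_exists[F /fin_all_exists[G FG]] (i : 'I_c) : exists F G : T i -> nat,
    [/\ forall u v, r i u v -> F u < F v, forall u v, s i u v -> G u < G v &
        forall u, [&& F u < t, G u < t & cell i (F u) (G u)]].
  have t0 : 0 < t by apply: leq_ltn_trans (ltn_ord (b i)).
  suff: V * t <= weight t (cell i) by move=> /(hforce i _ _ t0) [F [G HFG]]; exists F, G.
  rewrite mulnC -[t in t * V]subn0 -sum_nat_const_nat.
  rewrite /weight big_nat_cond [leqRHS]big_nat_cond.
  apply: leq_sum => y /andP[/andP[_ yt] _].
  have /forallP/(_ (tau i))/andP[_ hV] := splR _ (idx (rho i) _ yt).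
  apply: leq_trans hV _; rewrite -(@sum_shift_window _ _ _ t) ?breakpoint_le ?bmono //.
  by apply: leq_sum => x _; rewrite /cell; case: ifP.
apply: (@occurs_lex _ _ _ _ _ _ _ (fun i u => nth 0 R (rho i * t + F i u))
    (fun i u => breakpoint b (tau i) + G i u)) => [i j u v ij|i j u v ij|i u v ruv|i u v suv|i u].
- have [_ _ /(_ u)/and3P[Fu _ _]] := FG i; have [_ _ /(_ v)/and3P[Fv _ _]] := FG j.
  apply: ltR (idx _ _ Fv); apply: (@leq_trans ((rho i).+1 * t)); first lia.
  by apply: leq_trans (leq_addr _ _); rewrite leq_mul2r ij orbT.
- have [_ _ /(_ u)/and3P[_ _ /andP[Gu _]]] := FG i.
  by apply: leq_trans Gu _; apply: leq_trans (leq_addr _ _); apply: bmono.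
- have [Fr _ /(_ v)/and3P[Fv _ _]] := FG i.
  by apply: ltR (idx _ _ Fv); rewrite ltn_add2l Fr.
- by have [_ Gs _] := FG i; rewrite ltn_add2l Gs.
- have [_ _ /(_ u)/and3P[_ _ /andP[Gu ->]]] := FG i; rewrite andbT.
  exact: leq_trans Gu (breakpoint_le _ _).
Qed.

(** * The contraction recursion *)

Lemma sum_blocks (f : nat -> nat) N t :
  \sum_(0 <= i < N * t) f i = \sum_(0 <= I < N) \sum_(0 <= y < t) f (I * t + y).
Proof.
elim: N => [|N IH]; first by rewrite !big_geq.
rewrite big_nat_recr //= -IH (big_cat_nat (n := N * t)) ?leq_mul //=; congr (_ + _).
rewrite -{1}[N * t]add0n big_addn mulSn addnK.
by apply: eq_bigr => y _; rewrite addnC.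
Qed.

Lemma weight_blocks n N t A : n <= N * t ->
  weight n A <= \sum_(0 <= I < N) \sum_(0 <= J < N)
                  weight t (fun y x => A (I * t + y) (J * t + x)).
Proof.
move=> nN; apply: (@leq_trans (weight (N * t) A)).
  rewrite /weight [leqRHS](big_cat_nat (n := n)) //=; apply: leq_trans (leq_addr _ _).
  by apply: leq_sum => i _; rewrite [leqRHS](big_cat_nat (n := n)) //= leq_addr.
rewrite /weight sum_blocks; apply: leq_sum => I _.
rewrite exchange_big sum_blocks; apply: leq_sum => J _.
by rewrite exchange_big.
Qed.

Lemma sum_le_const (f : nat -> nat) n K :
  (forall i, f i <= K) -> \sum_(0 <= i < n) f i <= n * K.
Proof.
by move=> fK; rewrite -[X in X * _]subn0 -sum_nat_const_nat; apply: leq_sum.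
Qed.

Lemma weight_le_sqr n A : weight n A <= n * n.
Proof.
apply: sum_le_const => i; rewrite -[leqRHS]muln1.
by apply: sum_le_const => j; case: (A i j).
Qed.

(* Either the block is empty, or it has at least [q] nonempty rows or         *)
(* columns, or its ones lie in fewer than [q] rows and [q] columns.           *)
Lemma weight_block_cases t q A :
  weight t A <= q ^ 2 * [exists y : 'I_t, [exists x : 'I_t, A y x]]
    + t ^ 2 * (q <= \sum_(0 <= x < t) [exists y : 'I_t, A y x])
    + t ^ 2 * (q <= \sum_(0 <= y < t) [exists x : 'I_t, A y x]).
Proof.
have sq := weight_le_sqr t A; rewrite mulnn in sq.
have [_|lt1] := leqP q (\sum_(0 <= x < t) [exists y : 'I_t, A y x]).
  by rewrite muln1; apply: leq_trans sq _; rewrite -addnA addnCA leq_addr.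
have [_|lt2] := leqP q (\sum_(0 <= y < t) [exists x : 'I_t, A y x]).
  by rewrite muln1; apply: leq_trans sq _; rewrite leq_addl.
rewrite !muln0 !addn0; case: existsP => [_|none].
  rewrite muln1; apply: (@leq_trans (\sum_(0 <= y < t) \sum_(0 <= x < t)
      [exists x : 'I_t, A y x] * [exists y : 'I_t, A y x])).
    rewrite /weight big_nat_cond [leqRHS]big_nat_cond.
    apply: leq_sum => y /andP[/andP[_ yt] _].
    rewrite big_nat_cond [leqRHS]big_nat_cond; apply: leq_sum => x /andP[/andP[_ xt] _].
    case Axy: (A y x) => //.
    have -> : [exists x : 'I_t, A y x] by apply/existsP; exists (Ordinal xt).
    by have -> : [exists y : 'I_t, A y x] by apply/existsP; exists (Ordinal yt).
  under eq_bigr => y _ do rewrite -big_distrr /=.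
  by rewrite -big_distrl /= expnS expn1 leq_mul // ltnW.
rewrite muln0 leqn0 /weight big_mkord; apply/eqP/big1 => y _; rewrite big_mkord.
apply: big1 => x _; case Ayx: (A y x) => //; case: none.
by exists y; apply/existsP; exists x.
Qed.

Lemma weight_avoiding c (T : 'I_c -> finType) (r s : forall i, T i -> T i -> Prop)
    (rho tau : 'I_c -> 'I_c) V (t := 4 * (c * V) ^ 2) n A :
    0 < c -> 0 < V -> (forall i, forces (r i) (s i) V) ->
    ~ occurs (lex rho r) (lex tau s) A ->
  weight n A <= 8 * c * t ^ (c + 2) * n.
Proof.
move=> c0 V0 hforce; set q := c * V; set N0 := t ^ c * (c * t).
have q0 : 0 < q by rewrite muln_gt0 c0.
have t4 : 4 <= t by rewrite /t -/q leq_pmulr // expn_gt0 q0.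
have -> : 8 * c * t ^ (c + 2) = 8 * N0 * t by rewrite /N0 expnD; lia.
have N00 : 0 < N0 by rewrite /N0 !muln_gt0 expn_gt0 c0; lia.
elim/ltn_ind: n A => n IH A avoid.
have [nt|tn] := ltnP n t.
  apply: leq_trans (weight_le_sqr n A) _; rewrite leq_mul2r; apply/orP; right.
  by apply: leq_trans (ltnW nt) _; rewrite leq_pmull // muln_gt0 N00.
pose N := (n %/ t).+1.
have nN : n <= N * t by apply: ltnW; rewrite ltn_ceil //; lia.
(* Rounding up costs at most a factor 2, because t <= n; with 4 <= t this also makes N smaller than
   n. *)
have Nn : N * t <= 2 * n by rewrite /N; have := leq_trunc_div n t; lia.
have N_lt : N < n by have := leq_mul (leqnn N) t4; lia.
apply: leq_trans (weight_blocks A nN) _.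
pose w I J y x := A (I * t + y) (J * t + x).
apply: leq_trans (_ : _ <= \sum_(0 <= I < N) \sum_(0 <= J < N) _) _.
  apply: leq_sum => I _; apply: leq_sum => J _; exact: (weight_block_cases t q (w I J)).
under eq_bigr => I _ do rewrite !big_split /= -!big_distrr /=.
rewrite !big_split /= -!big_distrr /=.
have blk I y : y < t -> (I * t + y) %/ t = I.
  by move=> yt; rewrite divnMDl ?divn_small ?addn0 //; lia.
have hB : weight N (fun I J => [exists y : 'I_t, [exists x : 'I_t, w I J y x]])
    <= 8 * N0 * t * N.
  apply: IH => // occ; apply: avoid; move: occ.
  apply: (@occurs_lift _ _ _ _ _ (divn^~ t) (divn^~ t)).
  - by move=> i j; apply: leq_div2r.
  - by move=> i j; apply: leq_div2r.
  move=> I J /existsP[y /existsP[x wxy]].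
  by exists (I * t + y), (J * t + x); rewrite !blk.
have sub_mono J i j : i <= j -> i - J * t <= j - J * t by lia.
have hW : \sum_(0 <= I < N) \sum_(0 <= J < N)
    (q <= \sum_(0 <= x < t) [exists y : 'I_t, w I J y x]) <= N * N0.
  rewrite exchange_big; apply: sum_le_const => J /=.
  apply: (@strip_bound _ _ _ _ rho tau _ _ _
    (fun I x => [exists y : 'I_t, w I J y x]) V0 hforce).
  move=> occ; apply: avoid; move: occ; apply: (@occurs_lift _ _ _ _ _ (divn^~ t) (subn^~ (J * t))).
  - by move=> i j; apply: leq_div2r.
  - exact: sub_mono.
  move=> I x /andP[xt /existsP[y wyx]].
  by exists (I * t + y), (J * t + x); rewrite blk // addKn.
have hH : \sum_(0 <= I < N) \sum_(0 <= J < N)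
    (q <= \sum_(0 <= y < t) [exists x : 'I_t, w I J y x]) <= N * N0.
  apply: sum_le_const => I /=.
  (* Horizontal strips are handled by transposition, which exchanges [rho] with [tau] and [r] with
     [s]. *)
  apply: (@strip_bound _ _ _ _ tau rho _ _ _
    (fun J y => [exists x : 'I_t, w I J y x]) V0
    (fun i => forces_transpose (hforce i))).
  move=> /occurs_transpose occ; apply: avoid; move: occ.
  apply: (@occurs_lift _ _ _ _ _ (subn^~ (I * t)) (divn^~ t)).
  - exact: sub_mono.
  - by move=> i j; apply: leq_div2r.
  move=> y J /andP[yt /existsP[x wyx]].
  by exists (I * t + y), (J * t + x); rewrite blk // addKn.
have tE : t = 4 * q ^ 2 by [].
move: hB; rewrite /weight => hB.
have h1 := leq_mul (leqnn (q ^ 2)) hB; have h2 := leq_mul (leqnn (t ^ 2)) hW.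
have h3 := leq_mul (leqnn (t ^ 2)) hH.
apply: leq_trans (leq_add (leq_add h1 h2) h3) _.
have hn : 4 * N0 * t * (N * t) <= 4 * N0 * t * (2 * n) by rewrite leq_mul2l Nn orbT.
have -> : 8 * N0 * t * n = 4 * N0 * t * (2 * n) by lia.
apply: leq_trans hn; apply: eq_leq; clear -tE.
(* Since q^2 = t / 4, the recursive term is 2 t^2 N0 N, as much as both strip terms together. *)
have -> : q ^ 2 * (8 * N0 * t * N) = 2 * t * (N0 * t * N) by rewrite {2}tE; lia.
rewrite -mulnn; lia.
Qed.

(** * Translation to finite matrices and extremal numbers *)

Lemma ones_matrix n (A : nat -> nat -> bool) :
  ones (\matrix_(i < n, j < n) A i j) = weight n A.
Proof.
rewrite /ones -sum1_card /weight big_mkord.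
under [RHS]eq_bigr => i _ do rewrite big_mkord.
rewrite pair_big /= big_mkcond; apply: eq_bigr => -[i j] _.
by rewrite inE mxE /=; case: (A i j).
Qed.

Definition perm_occurs k (s : 'S_k) :=
  occurs (fun u v : 'I_k => u < v) (fun u v : 'I_k => s u < s v).

Lemma contains_permP n (A : nat -> nat -> bool) k (s : 'S_k) :
  contains (\matrix_(i < n, j < n) A i j) (perm_mx s) <->
  perm_occurs s (fun i j => [&& i < n, j < n & A i j]).
Proof.
split=> [/existsP[f /existsP[g /and3P[/'forall_forallP incf /'forall_forallP incg]]]|].
  move=> /'forall_forallP fgA; exists (fun u => f u : 'I_n), (fun u => g (s u) : 'I_n).
  split=> [u v uv|u v suv|u]; rewrite ?ltn_ord /=.
  - exact: (implyP (incf u v)).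
  - exact: (implyP (incg _ _)).
  by have := fgA u (s u); rewrite perm_mx_boolE eqxx !mxE.
move=> [F [G [incF incG FGA]]].
have Fn u : F u < n by have /and3P[] := FGA u.
have Gn u : G u < n by have /and3P[] := FGA u.
apply/existsP; exists [ffun u => Ordinal (Fn u)].
(* Occurrences index columns by positions, submatrices by values; hence the inverse of [s]. *)
apply/existsP; exists [ffun v => Ordinal (Gn ((s^-1)%g v))].
apply/and3P; split; apply/'forall_forallP => u v; apply/implyP; rewrite ?ffunE /=.
- exact: incF.
- by move=> uv; apply: incG; rewrite !permKV.
rewrite perm_mx_boolE => /eqP <-; rewrite !mxE !ffunE /= permK.
by have /and3P[] := FGA u.
Qed.

Lemma extremal_ge n (A : nat -> nat -> bool) k (s : 'S_k) :
    ~ perm_occurs s (fun i j => [&& i < n, j < n & A i j]) ->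
  weight n A <= extremal (perm_mx s) n.
Proof.
rewrite -ones_matrix => /contains_permP/negP avoid.
exact: (@leq_bigmax_cond _ _ (fun M : 'M[bool]_n => ones M)).
Qed.

Lemma extremal_le n k (s : 'S_k) K :
    (forall A : nat -> nat -> bool, ~ perm_occurs s A -> weight n A <= K) ->
  extremal (perm_mx s) n <= K.
Proof.
move=> bound; apply/bigmax_leqP => M avoid.
(* [M] extended by zeros, so every occurrence stays inside [M]. *)
pose A i j := [exists i' : 'I_n, exists j' : 'I_n,
  [&& i' == i :> nat, j' == j :> nat & M i' j']].
have AM i j : A i j -> i < n /\ j < n.
  by case/existsP=> i' /existsP[j' /and3P[/eqP<- /eqP<- _]].
have ME : (\matrix_(i < n, j < n) A i j)%R = M.
  apply/matrixP => i j; rewrite mxE; apply/existsP/idP => [[i' /existsP[j']]|Mij].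
    by case/and3P=> /eqP/val_inj-> /eqP/val_inj->.
  by exists i; apply/existsP; exists j; rewrite !eqxx.
rewrite -ME ones_matrix; apply: bound => -[F [G [incF incG FGA]]].
case/negP: avoid; rewrite -ME; apply/contains_permP; exists F, G; split=> // u.
by have [-> ->] := AM _ _ (FGA u); apply: FGA.
Qed.

Lemma forces_extremal k (s : 'S_k) V :
    (forall n, 0 < n -> extremal (perm_mx s) n < V * n) ->
  forces (fun u v : 'I_k => u < v) (fun u v : 'I_k => s u < s v) V.
Proof.
move=> small n A n0 dense.
case: (boolP (contains (\matrix_(i < n, j < n) A i j) (perm_mx s))) => [/contains_permP //|].
move/negP => avoid.
have /extremal_ge : ~ perm_occurs s (fun i j => [&& i < n, j < n & A i j]).
  by move/contains_permP.
by move=> /leq_ltn_trans/(_ (small n n0)); rewrite ltnNge dense.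
Qed.

(** * Inflations as lexicographic patterns *)

Lemma inflation_occurs c (sigma : 'S_c) (m : 'I_c -> nat)
    (P : forall i : 'I_c, 'S_(m i)) (A : nat -> nat -> bool) :
    occurs (lex (fun i : 'I_c => i : nat) (fun i (u v : 'I_(m i)) => u < v))
      (lex (fun i => sigma i : nat) (fun i (u v : 'I_(m i)) => P i u < P i v)) A ->
  perm_occurs (inflation sigma P) A.
Proof.
move=> [F [G [incF incG FGA]]].
exists (F \o tagnat.sig), (G \o tagnat.sig); split=> [x y xy|x y|x]; last exact: FGA.
- apply: incF; have : (tagnat.sig x < tagnat.sig y)%O by rewrite tagnat.lt_sig.
  case: (tagnat.sig x) (tagnat.sig y) => [i u] [j v]; rewrite Order.SigmaOrder.ltEsig /= !leEord.
  case: (ltngtP i j) => //= [ij _|/val_inj ij]; first by left.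
  by case: j / ij v => v; rewrite tagged_asE ltEord => uv; right; exists i, u, v.
- rewrite !permE /= => lt_xy; apply: incG.
  have [lt|lt|/val_inj/perm_inj eq_i] :=
      ltngtP (sigma (tag (tagnat.sig x))) (sigma (tag (tagnat.sig y))); first by left.
    by move: (inflation_val_mono P lt); rewrite ltnNge ltnW.
  case: (tagnat.sig x) (tagnat.sig y) eq_i lt_xy => [i u] [j v] /= ij.
  case: j / ij v => v; rewrite ltn_add2l => uv; right; exists i, u, v; split=> //.
Qed.

(** For c = 1 the inflation equals its block, but the types ['S_(m ord0)] and ['S_(\sum_i m i)]
    differ, so the two are compared through occurrences. *)
Lemma inflation_single_occurs (sigma : 'S_1) (m : 'I_1 -> nat)
    (P : forall i : 'I_1, 'S_(m i)) (A : nat -> nat -> bool) :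
  perm_occurs (P ord0) A -> perm_occurs (inflation sigma P) A.
Proof.
move=> occ; apply: inflation_occurs.
have /fin_all_exists[F /fin_all_exists[G FG]] (i : 'I_1) :
    exists F G : 'I_(m i) -> nat,
    [/\ forall u v : 'I_(m i), u < v -> F u < F v,
        forall u v : 'I_(m i), P i u < P i v -> G u < G v & forall u, A (F u) (G u)].
  by rewrite (ord1 i).
apply: (@occurs_lex _ _ _ _ _ _ _ F G) => [i j u v|i j u v|i|i|i].
- by have := ltn_ord j; lia.
- by have := ltn_ord (sigma j); lia.
- by have [] := FG i.
- by have [] := FG i.
- by have [] := FG i.
Qed.

Lemma inflation_extremal c (sigma : 'S_c) (m : 'I_c -> nat)
    (P : forall i : 'I_c, 'S_(m i)) V :
    0 < c -> 0 < V ->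
    (forall i n, 0 < n -> extremal (perm_mx (P i)) n < V * n) ->
  forall n, extremal (perm_mx (inflation sigma P)) n
              <= 8 * c * (4 * (c * V) ^ 2) ^ (c + 2) * n.
Proof.
move=> c0 V0 small n; apply: extremal_le => A avoid.
apply: (@weight_avoiding c (fun i => 'I_(m i)) (fun i u v => u < v)
  (fun i u v => P i u < P i v) id sigma) => // [i|occ].
  by apply: forces_extremal => k; apply: small.
by apply: avoid; apply: inflation_occurs.
Qed.

(** * The estimate of the exponent *)

Local Open Scope ring_scope.

Lemma ln_ge_half (R : realType) (x : R) : 2 <= x -> 2^-1 <= ln x.
Proof.
move=> x2; have ln2 : 2^-1 <= ln (2 : R).
  (* ln (1 + y) <= y at y = -1/2 gives -ln 2 <= -1/2. *)
  have := @le_ln1Dx R (- 2^-1).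
  have -> : 1 + - 2^-1 = 2^-1 :> R by lra.
  rewrite lnV ?posrE // lerN2; apply; lra.
by apply: le_trans ln2 _; rewrite ler_ln ?posrE //; apply: lt_le_trans x2.
Qed.

Theorem theorem2p4 (R : realType) (c : nat) (sigma : 'S_c) (m : 'I_c -> nat)
    (P : forall i : 'I_c, 'S_(m i)) (a : R) :
  (0 < c)%N -> (forall i, (0 < m i)%N) -> 0 < a ->
  let k := (\sum_i m i)%N in
  (forall (i : 'I_c) (n : nat),
     (extremal (perm_mx (P i)) n)%:R <= k%:R `^ a * n%:R :> R) ->
  let alpha := 2 * a + 8 * c%:R ^+ 2 + 32 * a * c%:R ^+ 2 * ln c%:R in
  forall n : nat,
    (extremal (perm_mx (inflation sigma P)) n)%:R <= k%:R `^ alpha * n%:R :> R.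
Proof.
move=> c0 m0 a0 k small alpha n.
have ck : (c <= k)%N.
  by rewrite -[leqLHS]card_ord -sum1_card; apply: leq_sum => i _; apply: m0.
have x1 : 1 <= k%:R :> R by rewrite ler1n (leq_trans c0).
(* For c = 1 the logarithm vanishes and the general bound would exceed alpha; the hypothesis on the
   only block suffices, as a <= alpha. *)
have [c1|c1] := leqP c 1.
  have {c0 c1}c1 : c = 1%N by apply/eqP; rewrite eqn_leq c1.
  subst c; have le_a : a <= alpha by rewrite /alpha ln1; lra.
  apply: le_trans (_ : k%:R `^ a * n%:R <= _); last first.
    by rewrite ler_wpM2r // ler_powR.
  apply: le_trans (small ord0 n); rewrite ler_nat; apply: extremal_le => A avoid.
  apply: extremal_ge => -[F [G [incF incG FGA]]]; apply: avoid.
  apply: inflation_single_occurs; exists F, G; split=> // u.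
  by have /and3P[] := FGA u.
set x : R := k%:R in small x1 *.
have x2 : 2 <= x by rewrite (ler_nat _ 2); apply: leq_trans c1 ck.
have x0 : 0 < x by lra.
have cx : c%:R <= x by rewrite ler_nat.
have c2 : 2 <= c%:R :> R by rewrite (ler_nat _ 2).
have powD (p q : R) : x `^ (p + q) = x `^ p * x `^ q.
  by apply: powRD; rewrite lt0r_neq0 ?implybT.
have pow1 : x `^ 1 = x by rewrite powRr1 // ltW.
pose V := (Num.truncn (x `^ a)).+1.
have xa1 : 1 <= x `^ a by rewrite -(powRr0 x) ler_powR // ltW.
have V_le : V%:R <= x `^ (a + 1).
  (* V <= k^a + 1 <= 2 k^a <= k^(a+1). *)
  rewrite powD pow1 -natr1; have := truncn_le (x `^ a); rewrite powR_ge0 => hV.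
  nra.
have smallV i l : (0 < l)%N -> (extremal (perm_mx (P i)) l < V * l)%N.
  move=> l0; rewrite -(ltr_nat R); apply: le_lt_trans (small i l) _.
  by rewrite natrM ltr_pM2r ?ltr0n // truncnS_gt.
have := @inflation_extremal c sigma m P V c0 isT smallV n.
rewrite -(ler_nat R) => /le_trans; apply; rewrite natrM ler_wpM2r //.
(* 4 c^2 <= k^4 and V^2 <= k^(2a+2). *)
have t_le : (4 * (c * V) ^ 2)%:R <= x `^ (2 * a + 6).
  rewrite natrM natrX natrM.
  have -> : 2 * a + 6 = (a + 1) + (a + 1) + 4%:R :> R by lra.
  rewrite (powD _ 4%:R) (powD (a + 1)) (powR_mulrn _ (ltW x0)) exprMn; set y := x `^ (a + 1) in V_le *.
  have y0 : 0 <= V%:R :> R by [].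
  have hV : V%:R ^+ 2 <= y * y by rewrite expr2 ler_pM.
  have hc : 4 * c%:R ^+ 2 <= x ^+ 4.
    have -> : x ^+ 4 = x ^+ 2 * x ^+ 2 by rewrite -exprD.
    have -> : 4 = 2 ^+ 2 :> R by lra.
    by apply: ler_pM; rewrite ?exprn_ge0 // lerXn2r ?nnegrE //; lra.
  rewrite mulrA (mulrC (y * y)) ler_pM ?mulr_ge0 ?exprn_ge0 //.
(* 8 c <= k^4, from 2 <= k and c <= k. *)
apply: le_trans (_ : x ^+ 4 * x `^ (2 * a + 6) ^+ (c + 2) <= _).
  rewrite (natrM _ (8 * c)) natrX (natrM _ 8 c); apply: ler_pM; rewrite ?mulr_ge0 ?exprn_ge0 //; last first.
    by rewrite lerXn2r ?nnegrE ?powR_ge0.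
  have -> : 8 = 2 ^+ 3 :> R by lra.
  rewrite (exprSr _ 3); apply: ler_pM; rewrite ?exprn_ge0 //.
  by rewrite lerXn2r ?nnegrE //; lra.
rewrite -(powR_mulrn _ (ltW x0)) -(powR_mulrn _ (powR_ge0 _ _)) -powRrM -powD; apply: ler_powR => //.
(* What remains is 4 + (2a+6)(c+2) <= alpha. It splits into 16 + 6c <= 8c^2 and a (2c+2) <= 16 a c^2
   <= 32 a c^2 ln c, both by c >= 2. *)
have lnc := ln_ge_half c2; rewrite /alpha natrD.
set C := c%:R in c2 lnc *; set L := ln C in lnc *.
have CL : C ^+ 2 * 2^-1 <= C ^+ 2 * L by rewrite ler_wpM2l // exprn_ge0 //; lra.
have CC : 2 * C <= C ^+ 2 by rewrite expr2 ler_wpM2r //; lra.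
have : a * (16 * C ^+ 2) <= a * (32 * C ^+ 2 * L) by rewrite (ler_wpM2l (ltW a0)) //; lra.
have : a * (2 * C + 2) <= a * (16 * C ^+ 2) by rewrite (ler_wpM2l (ltW a0)) //; lra.
lra.
Qed.
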